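(* Let $r \in [0,1]$ be a real number. Then the following are equivalent: (1) $r$ is the upper density of a $\Sigma^0_2$ set; (2) $r$ is left-$\Pi^0_3$; (3) $r$ is the upper density of a $\Pi^0_1$ set.
   Context: For $X \subseteq \omega=\{0,1,2,\dots\}$ and an integer $m>0$, let $\rho_m(X) = |\{j \in X : j < m\}|/m$. The upper density of $X$ is $\overline{\rho}(X)=\limsup_m \rho_m(X)$. A real $r$ is left-$\Pi^0_3$ if its left Dedekind cut $\{q \in \mathbb{Q} : q < r\}$ is a $\Pi^0_3$ set. *)

(* Defs.v *)
From mathcomp Require Import all_boot all_order all_algebra.
From mathcomp Require Import all_classical all_reals all_analysis.
Set Implicit Arguments.
Unset Strict Implicit.
Unset Printing Implicit Defensive.
Import Order.TTheory GRing.Theory Num.Theory.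
Local Open Scope ring_scope.

(** Kleene's partial recursive functions: [murec n] is the type of programs
    with [n] arguments. In [Rec f g] the recursion is on the first argument;
    [Mu f] minimizes over the first argument of [f]. *)
Inductive murec : nat -> Type :=
| Zero n : murec n
| Succ : murec 1
| Proj n : 'I_n -> murec n
| Comp k n : murec k -> ('I_k -> murec n) -> murec n
| Rec n : murec n -> murec n.+2 -> murec n.+1
| Mu n : murec n.+1 -> murec n.

(** [computes c v y]: the program [c] halts on input [v] with output [y]. In the
    case of [Rec], [s] is the sequence of the values reached by the recursion. *)
Fixpoint computes n (c : murec n) : n.-tuple nat -> nat -> Prop :=
  match c in murec n return n.-tuple nat -> nat -> Prop with
  | Zero _ => fun _ y => y = 0%N
  | Succ => fun v y => y = (thead v).+1
  | Proj _ i => fun v y => y = tnth v i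
  | Comp k _ f g => fun v y =>
      exists w : k.-tuple nat,
        (forall i, computes (g i) v (tnth w i)) /\ computes f w y
  | Rec n f g => fun v y =>
      exists s : nat -> nat,
        [/\ computes f [tuple of behead v] (s 0%N),
            forall i, (i < thead v)%N ->
              computes g [tuple of i :: s i :: behead v] (s i.+1)
          & y = s (thead v)]
  | Mu n f => fun v y =>
      computes f [tuple of y :: v] 0%N /\
      forall i, (i < y)%N -> exists z, computes f [tuple of i :: v] z.+1
  end.

Definition computable_rel k (P : k.-tuple nat -> Prop) : Prop :=
  exists c : murec k, forall v, computes c v `[< P v >].

(** The arithmetical hierarchy, for relations of any arity. *)
Fixpoint Sigma0 n k (P : k.-tuple nat -> Prop) {struct n} : Prop :=
  match n with
  | 0 => computable_rel P
  | n'.+1 => exists Q : k.+1.-tuple nat -> Prop,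
      Pi0 n' Q /\ forall v, P v <-> exists y, Q [tuple of y :: v]
  end
with Pi0 n k (P : k.-tuple nat -> Prop) {struct n} : Prop :=
  match n with
  | 0 => computable_rel P
  | n'.+1 => exists Q : k.+1.-tuple nat -> Prop,
      Sigma0 n' Q /\ forall v, P v <-> forall y, Q [tuple of y :: v]
  end.

Definition Sigma0_set n (X : set nat) : Prop :=
  Sigma0 n (fun v : 1.-tuple nat => X (thead v)).

Definition Pi0_set n (X : set nat) : Prop :=
  Pi0 n (fun v : 1.-tuple nat => X (thead v)).

(** Rationals are coded by triples of natural numbers: [(a, b, d)] codes
    [(a - b) / (d + 1)]. A rational has many codes, but whether two triples code
    the same rational is decidable. *)
Definition rat_of_code (v : 3.-tuple nat) : rat :=
  ((tnth v 0)%:R - (tnth v 1)%:R) / (tnth v 2).+1%:R.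

Definition Pi0_rat n (A : set rat) : Prop :=
  Pi0 n (fun v => A (rat_of_code v)).

Definition left_Pi0 n {R : realType} (r : R) : Prop :=
  Pi0_rat n [set q : rat | ratr q < r]%classic.

(** The value at [m = 0] is [0 / 0 = 0]; it does not affect the limit superior
    below. *)
Definition rho {R : realType} (X : set nat) (m : nat) : R :=
  #|[pred j : 'I_m | (j : nat) \in X]|%:R / m%:R.

Definition upper_density {R : realType} (X : set nat) : R := limn_sup (rho X).

(* Main.v *)
Require Import Defs.
From mathcomp Require Import all_boot all_order all_algebra.
From mathcomp Require Import all_classical all_reals all_analysis.
From mathcomp Require Import zify ring lra.
Import Order.TTheory GRing.Theory Num.Theory.
Local Open Scope ring_scope.
Set Implicit Arguments.
Unset Strict Implicit.
Unset Printing Implicit Defensive.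

(** Let [X] be Sigma^0_2 with upper density [r]. If [r] is rational its cut is
    decidable. Otherwise [q < r] is equivalent to [q <= r], that is, to: for
    every [n] there is [m >= n] with [rho_m(X) > q - 1/(n+1)]. The last
    inequality is Sigma^0_2, because a finite count of elements of [X] is already
    correct for some bound on the outer existential witnesses.

    Conversely, write the cut of [r] as [forall c, exists b, forall a, S].
    Call a pair [(N, q)], with the code of [q] below [N], verified if
    all rationals [q' <= q] with code below [N] satisfy
    [exists b, forall a, S] for all [c <= N]. If [q < r] then every [(N, q)] is
    verified, while for [q' > r] only finitely many verified pairs have
    [q >= q']. Being verified is Sigma^0_2, so it can be witnessed by a
    unique [t >= N] with a Pi^0_1 property; [q] is then said to be active at [t].
    Hence the limit superior, over [t], of the rationals active at [t] is [r].
    The Pi^0_1 set that has, for each [q] active at [t], the proportion [q] of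
    each residue period modulo [t] in the block from [t!] to [(t+1)!] has upper
    density [r], because each block dwarfs the preceding ones. *)

(** * Computable functions *)

Local Open Scope nat_scope.

(** Free variables are the entries of the environment [s], read with [nth 0],
    and the same [F] must be computable at every arity. *)
Definition computable_fun (F : seq nat -> nat) : Prop :=
  forall k, exists c : murec k, forall v : k.-tuple nat, computes c v (F v).

Definition computable_pred (P : seq nat -> Prop) : Prop :=
  computable_fun (fun s => `[<P s>]).

Lemma computable_fun_ext F G :
  F =1 G -> computable_fun F -> computable_fun G.
Proof. by move=> /funext ->. Qed.

Lemma computable_pred_ext (P Q : seq nat -> Prop) :
  (forall s, P s <-> Q s) -> computable_pred P -> computable_pred Q.
Proof. by move=> PQ; congr computable_pred; apply/funext => s; apply/propext. Qed.

Lemma computable_fun_const a : computable_fun (fun=> a).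
Proof.
move=> k; elim: a => [|a [c hc]]; first by exists (Zero k).
exists (Comp Succ (fun=> c)) => v /=.
by exists [tuple a]; split=> [i|//]; rewrite (tnth_nth 0) ord1; apply: hc.
Qed.

Lemma computable_fun_nth i : computable_fun (fun s => nth 0 s i).
Proof.
move=> k; case: (ltnP i k) => hi; last first.
  by exists (Zero k) => v /=; rewrite nth_default // size_tuple.
by exists (Proj (Ordinal hi)) => v /=; rewrite (tnth_nth 0).
Qed.

Lemma computable_fun_drop n i : computable_fun (fun s => nth 0 (drop n s) i).
Proof.
by apply: computable_fun_ext (computable_fun_nth (n + i)) => s; rewrite nth_drop.
Qed.

(** Below binders the original environment is an iterated [behead]. Describing it as a tail lets one
    tactic handle variables at every binding depth. *)
Definition is_drop (T : seq nat -> seq nat) := exists n, T =1 drop n.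

Lemma is_drop_id : is_drop (fun s => s).
Proof. by exists 0 => s; rewrite drop0. Qed.

Lemma is_drop_behead T : is_drop T -> is_drop (fun s => behead (T s)).
Proof. by move=> [n hn]; exists n.+1 => s; rewrite hn -drop1 drop_drop. Qed.

Lemma computable_fun_var T i : is_drop T -> computable_fun (fun s => nth 0 (T s) i).
Proof.
by move=> [n /funext ->]; apply: computable_fun_drop.
Qed.

Lemma computable_fun_head T : is_drop T -> computable_fun (fun s => head 0 (T s)).
Proof.
move=> /(@computable_fun_var T 0); apply: computable_fun_ext => s.
by rewrite nth0.
Qed.

Inductive computable_seq : (seq nat -> seq nat) -> Prop :=
| computable_seq_drop T : is_drop T -> computable_seq T
| computable_seq_nil : computable_seq (fun=> [::])
| computable_seq_cons f L : computable_fun f -> computable_seq L ->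
    computable_seq (fun s => f s :: L s).

(** [Comp] takes an outer program of one fixed arity, so the number of arguments may depend only on
    the length of the environment. *)
Lemma computable_seq_size L n : computable_seq L ->
  exists k, forall s, size s = n -> size (L s) = k.
Proof.
elim=> [T [m hT]||f {}L _ _ [k hk]].
- by exists (n - m) => s sn; rewrite hT size_drop sn.
- by exists 0.
- by exists k.+1 => s sn /=; rewrite hk.
Qed.

Lemma computable_seq_nth L i : computable_seq L ->
  computable_fun (fun s => nth 0 (L s) i).
Proof.
move=> cL; elim: cL i => [T hT||f {}L cf _ hL] i.
- exact: computable_fun_var.
- apply: computable_fun_ext (computable_fun_const 0) => s.
  by rewrite nth_nil.
- by case: i => [|i] /=.
Qed.

Lemma computable_fun_comp F L : computable_fun F -> computable_seq L ->
  computable_fun (fun s => F (L s)).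
Proof.
move=> cF cL n; have [k hk] := computable_seq_size n cL.
have [c hc] := cF k.
have [d hd] := choice (fun i : 'I_k => computable_seq_nth i cL n).
exists (Comp c d) => v /=.
have szL : size (L v) == k by rewrite hk// size_tuple.
exists (Tuple szL); split=> [i|]; last exact: hc.
by rewrite (tnth_nth 0); apply: hd.
Qed.

Lemma computable_pred_comp P L : computable_pred P -> computable_seq L ->
  computable_pred (fun s => P (L s)).
Proof. exact: computable_fun_comp. Qed.

Lemma computable_fun_comp1 (F : nat -> nat) f :
    computable_fun (fun s => F (nth 0 s 0)) -> computable_fun f ->
  computable_fun (fun s => F (f s)).
Proof.
move=> cF cf; have cL := computable_seq_cons cf computable_seq_nil.
exact: computable_fun_comp cF cL.
Qed.

Lemma computable_fun_comp2 (F : nat -> nat -> nat) f g :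
    computable_fun (fun s => F (nth 0 s 0) (nth 0 s 1)) ->
    computable_fun f -> computable_fun g ->
  computable_fun (fun s => F (f s) (g s)).
Proof.
move=> cF cf cg.
have cL := computable_seq_cons cf (computable_seq_cons cg computable_seq_nil).
exact: computable_fun_comp cF cL.
Qed.

Lemma computable_fun_succ f : computable_fun f ->
  computable_fun (fun s => (f s).+1).
Proof.
move=> cf k; have [c hc] := cf k.
exists (Comp Succ (fun=> c)) => v /=.
by exists [tuple f v]; split=> // i; rewrite (tnth_nth 0) ord1; apply: hc.
Qed.

(** [h] is characterised by its recursion equations, so an existing function can be used directly.
    The environment of [g] lists the index, the previous value and then [s], in the order that [Rec]
    uses. *)
Lemma computable_fun_rec (f : seq nat -> nat) (g : nat -> nat -> seq nat -> nat)
    (h : nat -> seq nat -> nat) (b : seq nat -> nat) :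
    (forall s, h 0 s = f s) -> (forall i s, h i.+1 s = g i (h i s) s) ->
    computable_fun f ->
    computable_fun (fun s => g (head 0 s) (head 0 (behead s)) (behead (behead s))) ->
    computable_fun b ->
  computable_fun (fun s => h (b s) s).
Proof.
move=> h0 hS cf cg cb n; have [c hc] := cf n; have [d hd] := cg n.+2.
have args (i : 'I_n.+1) : exists e : murec n,
    forall v : n.-tuple nat, computes e v (tnth [tuple of b v :: v] i).
  have ci : computable_fun (fun s => nth 0 (b s :: s) i).
    by case: i => -[|i] hi //=; apply: computable_fun_nth.
  have [e he] := ci n; exists e => v; have := he v.
  by rewrite (tnth_nth 0).
have [e he] := choice args.
exists (Comp (Rec c d) e) => v /=; exists [tuple of b v :: v]; split=> [i|].
  exact: he.
exists (fun i => h i v); split=> [|i ilt|].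
- by rewrite h0; move: (hc v); congr (computes c _ _); apply: val_inj.
- rewrite hS; move: (hd [tuple of i :: h i v :: v]).
  by congr (computes d _ _); apply: val_inj.
- by rewrite theadE.
Qed.

Ltac computable_var := first
  [ apply: computable_fun_head; repeat apply: is_drop_behead; exact: is_drop_id
  | apply: computable_fun_var; repeat apply: is_drop_behead; exact: is_drop_id ].

Lemma computable_fun_add f g : computable_fun f -> computable_fun g ->
  computable_fun (fun s => f s + g s).
Proof.
apply: computable_fun_comp2.
apply: (@computable_fun_rec (fun s => nth 0 s 1) (fun _ a _ => a.+1)
  (fun i s => i + nth 0 s 1)) => //.
- by computable_var.
- by apply: computable_fun_succ; computable_var.
- by computable_var.
Qed.

Lemma computable_fun_mul f g : computable_fun f -> computable_fun g ->
  computable_fun (fun s => f s * g s).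
Proof.
apply: computable_fun_comp2.
apply: (@computable_fun_rec (fun=> 0) (fun _ a s => nth 0 s 1 + a)
  (fun i s => i * nth 0 s 1)) => //.
- exact: computable_fun_const.
- by apply: computable_fun_add; computable_var.
- by computable_var.
Qed.

Lemma computable_fun_pred f : computable_fun f ->
  computable_fun (fun s => (f s).-1).
Proof.
apply: computable_fun_comp1.
apply: (@computable_fun_rec (fun=> 0) (fun i _ _ => i) (fun i _ => i.-1)) => //.
- exact: computable_fun_const.
- by computable_var.
- by computable_var.
Qed.

Lemma computable_fun_sub f g : computable_fun f -> computable_fun g ->
  computable_fun (fun s => f s - g s).
Proof.
apply: computable_fun_comp2.
apply: (@computable_fun_rec (fun s => nth 0 s 0) (fun _ a _ => a.-1)
  (fun i s => nth 0 s 0 - i)) => //.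
- by move=> s; rewrite subn0.
- by move=> i s; rewrite subnS.
- by computable_var.
- by apply: computable_fun_pred; computable_var.
- by computable_var.
Qed.

(** A bound variable is pushed on the environment, as in de Bruijn notation. *)
Lemma computable_fun_sum (F : nat -> seq nat -> nat) b :
    computable_fun b ->
    computable_fun (fun s => F (head 0 s) (behead s)) ->
  computable_fun (fun s => \sum_(0 <= i < b s) F i s).
Proof.
move=> cb cF.
apply: (@computable_fun_rec (fun=> 0) (fun i a s => a + F i s)
  (fun i s => \sum_(0 <= j < i) F j s)) => //.
- by move=> s; rewrite big_geq.
- by move=> i s; rewrite big_nat_recr.
- exact: computable_fun_const.
- apply: computable_fun_add; first by computable_var.
  (* The recursion step sees index, accumulator and environment; the accumulator is dropped because
     [F] expects only the other two. *)
  have cL : computable_seq (fun s => head 0 s :: behead (behead s)).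
    apply: computable_seq_cons; first by computable_var.
    by apply: computable_seq_drop; do 2 apply: is_drop_behead; apply: is_drop_id.
  exact: computable_fun_comp cF cL.
Qed.

Lemma computable_fun_fact f : computable_fun f -> computable_fun (fun s => (f s)`!).
Proof.
apply: computable_fun_comp1.
apply: (@computable_fun_rec (fun=> 1) (fun i a _ => i.+1 * a) (fun i _ => i`!)) => //.
- exact: computable_fun_const.
- by apply: computable_fun_mul; first apply: computable_fun_succ; computable_var.
- by computable_var.
Qed.

Lemma computable_pred_ltn f g : computable_fun f -> computable_fun g ->
  computable_pred (fun s => f s < g s).
Proof.
move=> cf cg; apply: (@computable_fun_ext (fun s => 1 - (1 - (g s - f s)))).
  by move=> s; rewrite asboolb; case: ltnP; lia.
by do !apply: computable_fun_sub => //; apply: computable_fun_const.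
Qed.

Lemma computable_pred_leq f g : computable_fun f -> computable_fun g ->
  computable_pred (fun s => f s <= g s).
Proof.
move=> cf cg; apply: (@computable_pred_ext (fun s => f s < (g s).+1)) => //.
exact: computable_pred_ltn (computable_fun_succ cg).
Qed.

Lemma computable_pred_and P Q : computable_pred P -> computable_pred Q ->
  computable_pred (fun s => P s /\ Q s).
Proof.
move=> cP cQ; apply: computable_fun_ext (computable_fun_mul cP cQ) => s.
by rewrite asbool_and; case: `[<P s>]; case: `[<Q s>].
Qed.

Lemma computable_pred_not P : computable_pred P -> computable_pred (fun s => ~ P s).
Proof.
move=> cP; have c1 := computable_fun_const 1.
apply: computable_fun_ext (computable_fun_sub c1 cP) => s.
by rewrite asbool_neg; case: `[<P s>].
Qed.

Lemma computable_pred_imp P Q : computable_pred P -> computable_pred Q ->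
  computable_pred (fun s => P s -> Q s).
Proof.
move=> cP cQ; apply: computable_pred_ext
  (computable_pred_not (computable_pred_and cP (computable_pred_not cQ))) => s.
by rewrite not_andP notK -implyNp notK.
Qed.

Lemma computable_pred_ex (P : nat -> seq nat -> Prop) b :
    computable_fun b ->
    computable_pred (fun s => P (head 0 s) (behead s)) ->
  computable_pred (fun s => exists i, i < b s /\ P i s).
Proof.
move=> cb cP.
have cS := computable_fun_sum (F := fun i s => `[<P i s>]) cb cP.
apply: computable_pred_ext (computable_pred_ltn (computable_fun_const 0) cS) => s.
rewrite lt0n sum_nat_seq_neq0; split.
  move=> /hasP[i]; rewrite mem_index_iota /= => ib; rewrite eqb0 negbK => /asboolP Pi.
  by exists i.
move=> [i [ib /asboolP Pi]]; apply/hasP; exists i; first by rewrite mem_index_iota.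
by rewrite /= Pi.
Qed.

Lemma computable_pred_all (P : nat -> seq nat -> Prop) b :
    computable_fun b ->
    computable_pred (fun s => P (head 0 s) (behead s)) ->
  computable_pred (fun s => forall i, i < b s -> P i s).
Proof.
move=> cb cP; have cN := computable_pred_ex (P := fun i s => ~ P i s) cb
  (computable_pred_not cP).
apply: computable_pred_ext (computable_pred_not cN) => s; split.
  by move=> nex i ib; apply: contrapT => nP; apply: nex; exists i.
by move=> hP [i [ib]]; apply; apply: hP.
Qed.

Lemma computable_fun_asbool P : computable_pred P ->
  computable_fun (fun s => `[<P s>]).
Proof. exact. Qed.

(** The remainder grows by 1 with [i] and is reset to 0 when it reaches the modulus. For modulus 0
    the reset never occurs, in accordance with [i %% 0 = i]. *)
Lemma computable_fun_mod f g : computable_fun f -> computable_fun g ->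
  computable_fun (fun s => f s %% g s).
Proof.
apply: computable_fun_comp2.
apply: (@computable_fun_rec (fun=> 0)
  (fun _ a s => a.+1 * `[<~ (a.+1 <= nth 0 s 1 /\ nth 0 s 1 <= a.+1)>])
  (fun i s => i %% nth 0 s 1)) => //.
- by move=> s; rewrite mod0n.
- move=> i s; set d := nth 0 s 1.
  have -> : `[<~ ((i %% d).+1 <= d /\ d <= (i %% d).+1)>] = ~~ (d %| i.+1).
    rewrite asbool_neg asbool_and !asboolb -eqn_leq; congr negb.
    have [->|d0] := posnP d; first by rewrite dvd0n.
    rewrite {2}(divn_eq i d) -addnS dvdn_addr ?dvdn_mull//.
    by apply/eqP/idP => [->//|/dvdn_leq-/(_ isT) h]; apply/eqP; rewrite eqn_leq ltn_pmod.
  by rewrite modnS; case: (d %| i.+1); rewrite ?muln0 ?muln1.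
- exact: computable_fun_const.
- apply: computable_fun_mul; first by apply: computable_fun_succ; computable_var.
  apply: computable_fun_asbool; apply: computable_pred_not.
  apply: computable_pred_and; apply: computable_pred_leq;
    by [computable_var | apply: computable_fun_succ; computable_var].
- by computable_var.
Qed.

(** * Normal forms for the arithmetical hierarchy *)

Lemma computable_pred_of_rel k (R : k.-tuple nat -> Prop) : computable_rel R ->
  exists2 P, computable_pred P & forall v : k.-tuple nat, R v <-> P v.
Proof.
(* A relation of arity [k] is extended to every environment by truncating it or padding it with
   zeros. *)
move=> [c hc]; exists (fun s => R [tuple nth 0 s i | i < k]).
  move=> n; have [d hd] := choice (fun i : 'I_k => computable_fun_nth i n).
  exists (Comp c d) => v /=; eexists; split; last exact: hc.
  by move=> i; rewrite tnth_mktuple; apply: hd.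
move=> v; rewrite (_ : [tuple _ | _ < _] = v)//.
by apply: eq_from_tnth => i; rewrite tnth_mktuple -tnth_nth.
Qed.

Lemma computable_rel_of_pred k P : computable_pred P ->
  computable_rel (fun v : k.-tuple nat => P v).
Proof. exact. Qed.

Lemma Pi0_1P k (R : k.-tuple nat -> Prop) : Pi0 1 R <->
  exists2 P, computable_pred P & forall v, R v <-> forall a, P (a :: v).
Proof.
split=> [[Q [/computable_pred_of_rel[P cP QP] RQ]]|[P cP RP]].
  by exists P => // v; rewrite RQ; split=> h a; apply/QP; apply: h.
by exists (fun v => P v); split=> //; apply: computable_rel_of_pred.
Qed.

Lemma Sigma0_2P k (R : k.-tuple nat -> Prop) : Sigma0 2 R <->
  exists2 P, computable_pred P & forall v, R v <-> exists b, forall a, P [:: a, b & v].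
Proof.
split=> [[Q [/Pi0_1P[P cP QP] RQ]]|[P cP RP]].
  by exists P => // v; rewrite RQ; split=> -[b hb]; exists b; apply/QP.
exists (fun v => forall a, P (a :: v)); split=> //.
by apply/Pi0_1P; exists P.
Qed.

Lemma Pi0_3P k (R : k.-tuple nat -> Prop) : Pi0 3 R <->
  exists2 P, computable_pred P &
    forall v, R v <-> forall c, exists b, forall a, P [:: a, b, c & v].
Proof.
split=> [[Q [/Sigma0_2P[P cP QP] RQ]]|[P cP RP]].
  by exists P => // v; rewrite RQ; split=> h c; apply/QP; apply: h.
exists (fun v => exists b, forall a, P [:: a, b & v]); split=> //.
by apply/Sigma0_2P; exists P.
Qed.

(** Bounded quantifiers are recognised only with a strict bound [i < b s]; hence the bounds of the
    form [N.+1] in the definitions below. *)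
Ltac computability := cbv beta; lazymatch goal with
  | |- computable_pred (fun s => @?P s /\ @?Q s) =>
      apply: computable_pred_and; computability
  | |- computable_pred (fun s => ~ @?P s) =>
      apply: computable_pred_not; computability
  | |- computable_pred (fun s => exists i : nat,
         is_true (leq (S i) (@?b s)) /\ @?P s i) =>
      refine (@computable_pred_ex (fun i s => P s i) b _ _); computability
  | |- computable_pred (fun s => forall i : nat,
         is_true (leq (S i) (@?b s)) -> @?P s i) =>
      refine (@computable_pred_all (fun i s => P s i) b _ _); computability
  | |- computable_pred (fun s => @?P s -> @?Q s) =>
      apply: computable_pred_imp; computability
  | |- computable_pred (fun s => is_true (leq (@?f s) (@?g s))) =>
      apply: computable_pred_leq; computability
  | h : computable_pred ?P |- computable_pred (fun s => ?P (@?L s)) =>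
      apply: (computable_pred_comp (L := L) h); computability
  | |- computable_fun (fun s => S (@?f s)) =>
      apply: computable_fun_succ; computability
  | |- computable_fun (fun s => addn (@?f s) (@?g s)) =>
      apply: computable_fun_add; computability
  | |- computable_fun (fun s => muln (@?f s) (@?g s)) =>
      apply: computable_fun_mul; computability
  | |- computable_fun (fun s => modn (@?f s) (@?g s)) =>
      apply: computable_fun_mod; computability
  | |- computable_fun (fun s => factorial (@?f s)) =>
      apply: computable_fun_fact; computability
  | |- computable_fun (fun s => \sum_(0 <= i < @?b s) @?F s i) =>
      refine (@computable_fun_sum (fun i s => F s i) b _ _); computability
  | |- computable_fun (fun s => nat_of_bool `[< @?P s >]) =>
      apply: (@computable_fun_asbool P); computability
  | |- computable_seq (fun=> [::]) => exact: computable_seq_nil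
  | |- computable_seq (fun s => @?f s :: @?L s) =>
      apply: computable_seq_cons; computability
  | |- computable_fun (fun=> ?a) => exact: computable_fun_const
  | |- _ => first [assumption | computable_var]
  end.

(** * Upper densities of sets made of blocks *)

Local Open Scope nat_scope.

Definition count_below (X : nat -> Prop) (m : nat) : nat :=
  \sum_(0 <= x < m) `[<X x>].

Definition in_block (t x : nat) : Prop := t`! <= x /\ x < t.+1`!.

Local Open Scope ring_scope.

(** * Limits superior and densities *)

Definition is_limsup {R : realType} (u : nat -> R) (r : R) : Prop :=
  (forall e : R, 0 < e -> exists N, forall n, (N <= n)%N -> u n <= r + e) /\
  (forall e : R, 0 < e -> forall N, exists n, (N <= n)%N /\ r - e < u n).

Lemma is_limsup_le {R : realType} (u : nat -> R) (r s : R) :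
  is_limsup u r -> is_limsup u s -> s <= r.
Proof.
move=> [ur _] [_ us]; apply/ler_addgt0Pr => e e0.
have e20 : 0 < e / 2 by rewrite divr_gt0.
have [N hN] := ur _ e20; have [n [Nn hn]] := us _ e20 N.
have := hN n Nn; lra.
Qed.

Lemma limn_supP {R : realType} (u : nat -> R) (r : R) :
  (forall n, 0 <= u n <= 1) -> limn_sup u = r <-> is_limsup u r.
Proof.
move=> u01.
have ubu : has_ubound (range u) by exists 1 => _ [n _ <-]; case/andP: (u01 n).
have lbu : has_lbound (range u) by exists 0 => _ [n _ <-]; case/andP: (u01 n).
have -> : limn_sup u = inf (range (sups u)).
  by apply/cvg_lim => //; apply: cvg_sups_inf.
set l := inf _.
have ubd := has_ubound_sdrop ubu.
have lbs : has_lbound (range (sups u)).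
  exists 0 => _ [n _ <-]; case/andP: (u01 n) => u0 _; apply: le_trans u0 _.
  by apply: ub_le_sup (ubd n) _ _; exists n => /=.
have ul : is_limsup u l.
  split=> e e0.
    have [|_ [N _ <-] hN] := inf_adherent (E := range (sups u)) e0.
      by split=> //; exists (sups u 0%N); exists 0%N.
    exists N => n Nn; apply: le_trans (ltW hN).
    by apply: ub_le_sup (ubd N) _ _; exists n.
  move=> N; have : l - e < sups u N.
    have : l <= sups u N by apply: ge_inf => //; exists N.
    lra.
  have /sup_gt h : (sdrop u N !=set0)%classic by exists (u N); exists N => /=.
  by move=> /h[_ [n /= Nn <-] hn]; exists n.
split=> [<- //|ur]; apply/eqP; rewrite eq_le.
by rewrite (is_limsup_le ur ul) (is_limsup_le ul ur).
Qed.

Lemma count_below_le X m : (count_below X m <= m)%N.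
Proof.
rewrite -[leqRHS]muln1 -[X in (_ <= X * _)%N]subn0 -sum_nat_const_nat.
by apply: leq_sum => i _; case: `[<X i>].
Qed.

Lemma rhoE {R : realType} (X : set nat) (m : nat) :
  rho X m = (count_below X m)%:R / m%:R :> R.
Proof.
rewrite /rho /count_below big_mkord; congr (_%:R / _).
by rewrite -sum1_card big_mkcond; apply: eq_bigr => i _; rewrite inE; case: asboolP => h;
  [rewrite mem_set|rewrite memNset].
Qed.

Lemma rho_ge0_le1 {R : realType} (X : set nat) (m : nat) : 0 <= (rho X m : R) <= 1.
Proof.
rewrite rhoE divr_ge0 ?ler0n//=; case: m => [|m].
  by rewrite invr0 mulr0.
by rewrite ler_pdivrMr ?ltr0n// mul1r ler_nat count_below_le.
Qed.

Lemma upper_densityP {R : realType} (X : set nat) (r : R) :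
  upper_density X = r <-> is_limsup (rho X) r.
Proof. by apply: limn_supP => n; apply: rho_ge0_le1. Qed.

Section cells.
Variables (R : realType) (t : nat) (w : R).

(** For [w >= 0] this is the minimum of [n] and the integer part of [w], written as the count of
    residues in which it arises. *)
Definition cell (n : nat) : nat := (\sum_(0 <= i < n) (i.+1%:R <= w)%R)%N.

Lemma cell_le n : 0 <= w -> (cell n)%:R <= w.
Proof.
move=> w0; elim: n => [|n IH]; rewrite /cell; first by rewrite big_geq.
rewrite big_nat_recr//= -/(cell n); case: (leP n.+1%:R w) => h /=; last by rewrite addn0.
apply: le_trans h; rewrite ler_nat addn1 ltnS.
rewrite -[leqRHS]muln1 -[X in (_ <= X * _)%N]subn0 -sum_nat_const_nat.
by apply: leq_sum => i _; apply: leq_b1.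
Qed.

Lemma cell_ge n : w <= n%:R -> w - 1 <= (cell n)%:R.
Proof.
move=> wn; suff [|//] : (n <= cell n)%N \/ w - 1 <= (cell n)%:R.
  rewrite -(ler_nat R); lra.
elim: n {wn} => [|n IH]; first by left.
have -> : cell n.+1 = (cell n + (n.+1%:R <= w)%R)%N by rewrite /cell big_nat_recr.
case: (leP n.+1%:R w) => h /=; last rewrite addn0.
  case: IH => IH; [left; lia|right]; rewrite natrD; lra.
case: IH => IH; right => //; move: IH h; rewrite -(ler_nat R) -natr1; lra.
Qed.

Lemma sum_cells K L : (K <= L)%N ->
  (\sum_(K * t <= x < L * t) ((x %% t)%N.+1%:R <= w)%R = (L - K) * cell t)%N.
Proof.
move=> /subnKC <-; rewrite addKn; elim: (L - K)%N => [|d IH].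
  by rewrite addn0 big_geq.
rewrite (@big_cat_nat _ _ _ ((K + d) * t)%N) ?leq_mul2r ?addnS ?leqnSn ?leq_addr ?orbT//=.
rewrite {}IH [RHS]mulSn [RHS]addnC; congr (_ + _)%N.
rewrite mulSn -[X in (\sum_(X <= _ < _) _)%N]add0n big_addn addnK /cell.
rewrite !big_nat; apply: eq_bigr => i /andP[_ it].
by rewrite addnC modnMDl modn_small.
Qed.

End cells.

(** * Factorial blocks *)

Lemma fact_le m n : (m <= n)%N -> (m`! <= n`!)%N.
Proof.
move=> /subnKC <-; elim: (n - m)%N => [|d IH]; first by rewrite addn0.
by rewrite addnS factS (leq_trans IH)// leq_pmull.
Qed.

Lemma fact_ge n : (n <= n`!)%N.
Proof. by case: n => // n; rewrite factS leq_pmulr ?fact_gt0. Qed.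

Lemma in_block_inj t t' x : in_block t x -> in_block t' x -> t = t'.
Proof.
move=> [tx xt] [tx' xt']; apply/eqP; rewrite eqn_leq.
by apply/andP; split; rewrite leqNgt; apply/negP => /fact_le h; lia.
Qed.

Lemma in_block_ex x : (0 < x)%N -> exists t, in_block t.+1 x.
Proof.
move=> x0; have ex : exists t, (t`! <= x)%N by exists 0%N.
have ub t : (t`! <= x)%N -> (t <= x)%N.
  exact/leq_trans/fact_ge.
case: (ex_maxnP ex ub) => -[|t] tx tmax; first by have := tmax 1%N x0.
by exists t; split=> //; rewrite ltnNge; apply/negP => /tmax; rewrite ltnn.
Qed.

(** A value [q] in the unit interval selects the first [q t] residues, rounded down, of each period.
    Different values at the same [t] select nested sets. Block 0 is empty, as [0! = 1!]. *)
Definition block_set {R : realType} (A : nat -> R -> Prop) : set nat :=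
  [set x | exists t q, [/\ in_block t x, A t q & (x %% t)%N.+1%:R <= q * t%:R]]%classic.

(** Once [m >= (t+1)!], at most [m / t] numbers lie below [t!], so for the upper estimate only the
    last two blocks matter. The lower estimate is read off at the end of a block. *)
Lemma block_set_upper_density {R : realType} (A : nat -> R -> Prop) (r : R) :
    0 <= r <= 1 ->
    (forall e : R, 0 < e -> exists T, forall t q, (T <= t)%N -> A t q -> q <= r + e) ->
    (forall e : R, 0 < e -> forall T, exists t q, [/\ (T <= t)%N, A t q & r - e < q]) ->
  upper_density (block_set A) = r.
Proof.
move=> /andP[r0 r1] Ale Age; apply/upper_densityP; set X := block_set A; split=> e e0.
  pose d := e / 2; have d0 : 0 < d by rewrite divr_gt0.
  have [T hT] := Ale _ d0; pose b := r + d; have b0 : 0 <= b by rewrite addr_ge0// ltW.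
  (* For [t >= M] the errors are at most [(1 + 2 b) m / t <= d m]: the numbers below [t!] give
     [m / t], and the incomplete periods in the last two blocks give [b (2 t + 1) <= 2 b m / t]. *)
  have [M hM] : exists M : nat, (1 + 2 * b) / d <= M%:R.
    by exists (Num.truncn ((1 + 2 * b) / d)).+1; apply/ltW/truncnS_gt.
  pose S := (maxn T M).+1.
  (* Rounding [m] up to a multiple of [t] costs at most one period, whence the summand [t]. The
     condition is on [m.-1] so that the end of the block, [m = (t+1)!], is allowed. *)
  have block_le t m : (T <= t)%N -> (0 < t)%N -> in_block t m.-1 -> (0 < m)%N ->
      (\sum_(t`! <= x < m) `[<X x>])%:R <= b * (m%:R - t`!%:R + t%:R).
    move=> Tt t0 tm m0.
    have tE : t`! = (t.-1`! * t)%N by case: t t0 {Tt tm} => // t _; rewrite factS mulnC.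
    have mE : (m <= (m %/ t).+1 * t)%N
      by rewrite mulSn {1}(divn_eq m t); have := ltn_pmod m t0; lia.
    have tm' : (t`! <= m)%N by case: tm; lia.
    have kl : (t.-1`! <= (m %/ t).+1)%N.
      by rewrite -(leq_pmul2r t0) -tE (leq_trans tm').
    apply: (@le_trans _ _ (((m %/ t).+1 - t.-1`!) * cell (b * t%:R) t)%:R).
      rewrite -sum_cells// -tE ler_nat [leqRHS](@big_cat_nat _ _ _ m)//=.
      apply: leq_trans (leq_addr _ _).
      rewrite !big_nat; apply: leq_sum => x /andP[tx xm].
      case: asboolP => //= -[t' [q [tx' Atq hq]]].
      have tt' : t = t'.
        by apply: in_block_inj tx'; case: tm; split; lia.
      rewrite -{}tt' in Atq hq; rewrite lt0b; apply: le_trans hq _.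
      by apply: ler_wpM2r => //; apply: hT Atq.
    rewrite natrM; apply: (@le_trans _ _ (((m %/ t).+1 - t.-1`!)%:R * (b * t%:R))).
      by rewrite ler_wpM2l// cell_le// mulr_ge0.
    rewrite mulrCA ler_wpM2l// -natrM mulnBl -tE natrB; last first.
      by rewrite tE leq_mul2r kl orbT.
    rewrite mulSn natrD.
    have : ((m %/ t * t)%:R : R) <= m%:R by rewrite ler_nat leq_trunc_div.
    lra.
  exists (S.+1)`! => m Sm.
  have m0 : (0 < m)%N by rewrite (leq_trans _ Sm)// fact_gt0.
  have [t [tm mt]] := in_block_ex m0.
  have St : (S <= t)%N.
    rewrite leqNgt; apply/negP => tS; have := leq_trans Sm (ltnW mt).
    have : (t.+2`! <= S.+1`!)%N by apply: fact_le.
    lia.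
  have t0 : (0 < t)%N by lia.
  have tt := fact_gt0 t.
  have h1 := @block_le t (t.+1)`!; have h2 := @block_le t.+1 m.
  rewrite rhoE ler_pdivrMr ?ltr0n//.
  have -> : count_below X m = (count_below X t`! + \sum_(t`! <= x < t.+1`!) `[<X x>]
      + \sum_(t.+1`! <= x < m) `[<X x>])%N.
    rewrite /count_below -big_cat_nat//=; last by apply: fact_le.
    by rewrite -big_cat_nat.
  have {}h1 : (\sum_(t`! <= x < t.+1`!) `[<X x>])%:R <= b * (t.+1`!%:R - t`!%:R + t%:R).
    apply: h1 => //; [lia| |exact: fact_gt0].
    have : (t`! < t.+1`!)%N by rewrite factS mulSn -addn1 leq_add2l muln_gt0 t0 fact_gt0.
    split; lia.
  have {}h2 : (\sum_(t.+1`! <= x < m) `[<X x>])%:R <= b * (m%:R - t.+1`!%:R + t.+1%:R).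
    have [<-|mne] := eqVneq (t.+1)`! m.
      by rewrite big_geq// subrr add0r mulr_ge0.
    by apply: h2 => //; [lia|split; lia].
  have h0 : ((count_below X t`!)%:R : R) <= t`!%:R by rewrite ler_nat count_below_le.
  have tR : 0 < (t%:R : R) by rewrite ltr0n.
  have f1 : (t`!%:R : R) * t%:R <= m%:R.
    rewrite -natrM ler_nat (leq_trans _ tm)// factS mulnC leq_mul2r leqnSn orbT//.
  have f2 : ((2 * t + 1)%:R : R) * t%:R <= 2 * m%:R.
    rewrite -!natrM ler_nat; have : (t.+1 * t <= m)%N.
      by apply: leq_trans tm; rewrite factS leq_mul2l fact_ge orbT.
    move=> h; apply: (@leq_trans (2 * (t.+1 * t))%N); last by rewrite leq_mul2l.
    by rewrite mulnA leq_mul2r; apply/orP; right; clear; lia.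
  have f3 : 1 + 2 * b <= d * t%:R.
    rewrite [leRHS]mulrC -ler_pdivrMr// (le_trans hM)// ler_nat.
    by apply: leq_trans St; rewrite leqW// leq_maxr.
  have mR : 0 < (m%:R : R) by rewrite ltr0n.
  rewrite !natrD -(ler_pM2r tR).
  have -> : (r + e) * m%:R * t%:R = b * m%:R * t%:R + (d * t%:R) * m%:R.
    by rewrite /b /d; field.
  have f4 : (1 + 2 * b) * m%:R <= (d * t%:R) * m%:R by rewrite ler_wpM2r// ltW.
  apply: le_trans (lerD (lexx _) f4).
  have f5 : b * ((2 * t + 1)%:R * t%:R) <= b * (2 * m%:R) by rewrite ler_wpM2l.
  have f6 := ler_wpM2r (ltW tR) h0; have f7 := ler_wpM2r (ltW tR) h1.
  have f8 := ler_wpM2r (ltW tR) h2.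
  rewrite -[t.+1%:R]natr1 in f8; rewrite natrD natrM in f5.
  have f9 : 0 <= b * t`!%:R * t%:R by rewrite !mulr_ge0.
  lra.
(* At [m = (t+1)!] the density is at least [(q t - 1) / (t + 1)]. For [q <= 1] this falls short of
   [q] by at most [2 / (t + 1)], which is at most [e / 2] if [t >= M]. *)
move=> N; have [M hM] : exists M : nat, 4 / e <= M%:R.
  by exists (Num.truncn (4 / e)).+1; apply/ltW/truncnS_gt.
have e20 : 0 < e / 2 by rewrite divr_gt0.
have [t [q0 [Tt Atq hq0]]] := Age _ e20 (maxn N M).+1.
(* A period has only [t] residues, so values above 1 are capped; since [r <= 1], the cap stays above
   [r - e / 2]. *)
pose q := Num.min q0 1.
have qq : q <= q0 by rewrite /q ge_min lexx.
have q1 : q <= 1 by rewrite /q ge_min lexx orbT.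
have hq : r - e / 2 < q by rewrite /q lt_min hq0; lra.
have t0 : (0 < t)%N by lia.
have tt : (t < (t.+1)`!)%N by rewrite factS leq_pmulr ?fact_gt0.
exists (t.+1)`!; split.
  by apply: leq_trans (ltnW tt); apply: leq_trans (ltnW Tt); rewrite leq_maxl.
rewrite rhoE ltr_pdivlMr ?ltr0n ?fact_gt0//.
have tE : t`! = (t.-1`! * t)%N by case: t t0 {Tt Atq tt} => // t _; rewrite factS mulnC.
have tE1 : t.+1`! = ((t.+1 * t.-1`!) * t)%N by rewrite factS tE mulnA.
(* Block [t] consists of [(t+1) (t-1)! - (t-1)! = t!] full periods of length [t]. *)
have cnt : (t`! * cell (q * t%:R) t <= count_below X (t.+1)`!)%N.
  have -> : t`! = (t.+1 * t.-1`! - t.-1`!)%N by rewrite mulSn addKn mulnC.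
  rewrite -sum_cells; last by rewrite mulSn leq_addr.
  rewrite -tE -tE1 /count_below [leqRHS](@big_cat_nat _ _ _ t`!)//=; last exact: fact_le.
  apply: leq_trans (leq_addl _ _).
  rewrite !big_nat; apply: leq_sum => x /andP[tx xt].
  case: leP => //= h; rewrite lt0b; apply/asboolP; exists t, q0; split=> //.
  by apply: le_trans h _; rewrite ler_wpM2r.
move: cnt; rewrite -(ler_nat R) natrM; apply: lt_le_trans.
have hc : q * t%:R - 1 <= (cell (q * t%:R) t)%:R.
  by apply: cell_ge; rewrite -[leRHS]mul1r ler_wpM2r.
have tR : 0 < (t`!%:R : R) by rewrite ltr0n fact_gt0.
rewrite factS mulnC natrM mulrCA ltr_pM2l//; apply: lt_le_trans hc.
have ht : 4 <= e * (t.+1%:R).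
  rewrite [leRHS]mulrC -ler_pdivrMr// (le_trans hM)// ler_nat.
  by rewrite leqW// (leq_trans _ (ltnW Tt))// leq_maxr.
rewrite -natr1 in ht *.
have : (t%:R + 1) * (r - e / 2) < (t%:R + 1) * q by rewrite ltr_pM2l// natr1 ltr0n.
nra.
Qed.

(** * From left-Pi^0_3 reals to Pi^0_1 sets *)

Local Open Scope nat_scope.

(** * Exchanging bounded and unbounded quantifiers *)

Lemma finite_collection (I : finType) (phi : I -> nat -> Prop) :
    (forall i m n, m <= n -> phi i m -> phi i n) ->
    (forall i, exists n, phi i n) ->
  exists n, forall i, phi i n.
Proof.
move=> phiS /choice[f hf]; exists (\max_i f i) => i.
exact: phiS (leq_bigmax i) (hf i).
Qed.

(** If each of the finitely many candidates failed at some stage, all would fail at a common later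
    one. A bounded existential quantifier may thus stand inside a universal one, which keeps the
    definitions below Pi^0_1. *)
Lemma finite_pigeonhole (I : finType) (phi : I -> nat -> Prop) :
    (forall i m n, m <= n -> phi i n -> phi i m) ->
    (forall n, exists i, phi i n) ->
  exists i, forall n, phi i n.
Proof.
move=> phiS ex; apply: contrapT => nex.
have [|i|n hn] := @finite_collection I (fun i n => ~ phi i n).
- by move=> i m n mn nphi /(phiS _ _ _ mn).
- by apply/existsNP => all; apply: nex; exists i.
by have [i] := ex n; apply: hn.
Qed.

Lemma ex_min (P : nat -> Prop) : (exists n, P n) ->
  exists n, P n /\ forall m, m < n -> ~ P m.
Proof.
move=> exP; have exb : exists n, `[<P n>] by case: exP => n /asboolP; exists n.
case: (ex_minnP exb) => n /asboolP Pn nmin; exists n; split=> // m mn /asboolP/nmin.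
by rewrite leqNgt mn.
Qed.

(** If [v B] holds at all stages for some [B], the least such [B], paired with the
    least stage [t >= N, B] at which all smaller candidates have been refuted, is
    the only pair that [settles] and is never refuted. *)
Section settling.
Variables (v : nat -> nat -> Prop) (N : nat).
Hypothesis v_anti : forall B s s', s <= s' -> v B s' -> v B s.

(** The clauses [N <= t] and [B <= t] make every parameter of an element [x] of block [t] at most
    [x]; the first also sends [t] to infinity with [N]. *)
Definition caught_up (B t : nat) : Prop :=
  N <= t /\ B <= t /\ forall B', B' < B -> ~ v B' t.

Definition settles (B t : nat) : Prop :=
  caught_up B t /\ forall t', t' < t -> ~ caught_up B t'.

Lemma settles_ex :
  (exists B, forall s, v B s) -> exists B t, settles B t /\ forall s, v B s.
Proof.
move=> /ex_min[B [vB Bmin]]; exists B.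
have [t [ut tmin]] : exists t, settles B t; last by exists t.
apply: ex_min; have [| |s hs] := @finite_collection 'I_B (fun i s => ~ v i s).
- by move=> i m n mn nv /(v_anti mn).
- by move=> i; apply/existsNP; apply: Bmin.
exists (maxn s (maxn N B)); rewrite /caught_up !leq_max !leqnn !orbT; do 2 split=> //.
by move=> B' ltB' /(v_anti (leq_maxl _ _)); apply: (hs (Ordinal ltB')).
Qed.

Lemma settles_inj B t B' t' : (forall s, v B s) -> (forall s, v B' s) ->
  settles B t -> settles B' t' -> t = t'.
Proof.
move=> vB vB' [cB tmin] [cB' tmin'].
have eqB : B = B'.
  case: cB cB' => _ [_ h] [_ [_ h']]; case: (ltngtP B B') => // lt.
    by case: (h' _ lt).
  by case: (h _ lt).
rewrite -{}eqB in cB' tmin'; case: (ltngtP t t') => // lt.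
  by case: (tmin' _ lt).
by case: (tmin _ lt).
Qed.

End settling.

(** Denominators are cleared and subtracted terms moved across, so that the comparison of rationals
    uses only addition and multiplication of natural numbers. *)
Definition code_le (i0 i1 i2 j0 j1 j2 : nat) : Prop :=
  i0 * j2.+1 + j1 * i2.+1 <= j0 * i2.+1 + i1 * j2.+1.

Definition code_val {R : realType} (a b d : nat) : R :=
  ((a%:R - b%:R) / d.+1%:R)%R.

Lemma code_leP {R : realType} i0 i1 i2 j0 j1 j2 :
  code_le i0 i1 i2 j0 j1 j2 <-> (code_val i0 i1 i2 <= code_val j0 j1 j2 :> R)%R.
Proof.
rewrite /code_le /code_val ler_pdivrMr ?ltr0n// mulrAC ler_pdivlMr ?ltr0n//.
rewrite !mulrBl -!natrM lerBlDr addrAC lerBrDr -!natrD ler_nat.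
by split; lia.
Qed.

Lemma ratr_code {R : realType} (v : 3.-tuple nat) :
  (ratr (rat_of_code v) = code_val (nth 0%N v 0) (nth 0%N v 1) (nth 0%N v 2) :> R)%R.
Proof.
rewrite /rat_of_code /code_val !(tnth_nth 0) /=.
by rewrite fmorph_div rmorphB /= !ratr_nat.
Qed.

Lemma code_val_rat {R : realType} (q : rat) :
  exists a b d, (code_val a b d = ratr q :> R)%R.
Proof.
have dE : ((denq q) = (`|denq q|.-1.+1)%:Z)%R.
  by have := denq_gt0 q; case: (denq q) => -[|n].
have nE : exists a b : nat, (numq q = a%:Z - b%:Z)%R.
  case: (numq q) => n; first by exists n, 0%N; rewrite subr0.
  by exists 0%N, n.+1; rewrite sub0r NegzE.
have [a [b ab]] := nE; exists a, b, `|denq q|.-1.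
by rewrite /ratr ab dE /code_val rmorphB.
Qed.

(** * Verified pairs and active rationals *)

Section active.
Variables (R : realType) (r : R) (S : seq nat -> Prop).
Hypothesis S_cut : forall i0 i1 i2, (code_val i0 i1 i2 < r)%R <->
  forall c, exists b, forall a, S [:: a; b; c; i0; i1; i2].

(** [B] bounds the witnesses [b] and [s] truncates the quantifier over [a], so the relation is
    decidable when [S] is. The pair is verified in the full sense when some [B] works for all
    [s]. *)
Definition verified (N j0 j1 j2 B s : nat) : Prop :=
  forall i0, i0 < N.+1 -> forall i1, i1 < N.+1 -> forall i2, i2 < N.+1 ->
    code_le i0 i1 i2 j0 j1 j2 ->
    forall c, c < N.+1 -> exists b, b < B.+1 /\
      forall a, a < s.+1 -> S [:: a; b; c; i0; i1; i2].

Lemma verified_anti N j0 j1 j2 B s s' :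
  s <= s' -> verified N j0 j1 j2 B s' -> verified N j0 j1 j2 B s.
Proof.
move=> ss' h i0 h0 i1 h1 i2 h2 ij c hc; have [b [bB hb]] := h i0 h0 i1 h1 i2 h2 ij c hc.
by exists b; split=> // a ?; apply: hb; apply: leq_trans ss'.
Qed.

Definition active (t : nat) (q : R) : Prop :=
  exists N j0 j1 j2 B, [/\ [/\ j0 <= N, j1 <= N & j2 <= N], q = code_val j0 j1 j2,
    settles (verified N j0 j1 j2) N B t & forall s, verified N j0 j1 j2 B s].

(** Every rational up to the given one lies in the cut, so collection over the codes and the [c] up
    to [N] yields a common bound [B]. Taking [N >= T] forces the settling stage beyond [T]. *)
Lemma active_below j0 j1 j2 T : (code_val j0 j1 j2 < r)%R ->
  exists2 t, T <= t & active t (code_val j0 j1 j2).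
Proof.
move=> jr; pose N := maxn T (maxn j0 (maxn j1 j2)).
have [| |B hB] := @finite_collection ('I_N.+1 * 'I_N.+1 * 'I_N.+1 * 'I_N.+1)%type
  (fun '(i0, i1, i2, c) B => code_le i0 i1 i2 j0 j1 j2 ->
    exists b, b < B.+1 /\ forall a,
      S [:: a; b; nat_of_ord c; nat_of_ord i0; nat_of_ord i1; nat_of_ord i2]).
- move=> [[[i0 i1] i2] c] m n mn h /h[b [bm hb]]; exists b; split=> //.
  exact: leq_trans bm _.
- move=> [[[i0 i1] i2] c]; have [ij|nij] := pselect (code_le i0 i1 i2 j0 j1 j2); last first.
    by exists 0.
  have /S_cut/(_ c)[b hb] : (code_val i0 i1 i2 < r)%R.
    by apply: le_lt_trans jr; apply/code_leP.
  by exists b => _; exists b.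
have [| |B' [t [hst hver]]] := settles_ex (v := verified N j0 j1 j2) N _ _.
- by move=> *; apply: verified_anti; eassumption.
- exists B => s i0 h0 i1 h1 i2 h2 ij c hc.
  have [b [bB hb]] := hB (Ordinal h0, Ordinal h1, Ordinal h2, Ordinal hc) ij.
  by exists b; split.
exists t; last by exists N, j0, j1, j2, B'; split=> //; rewrite /N; split; lia.
by case: hst => -[Nt _] _; rewrite /N in Nt; lia.
Qed.

(** The rational is outside the cut, so some [c] refutes it. A large [N] covers both this [c] and
    the code, which excludes every [q] above; each of the finitely many pairs with small [N] is
    active at one stage at most. *)
Lemma active_above i0 i1 i2 : (r <= code_val i0 i1 i2)%R ->
  exists T, forall t q, T <= t -> active t q -> (q < code_val i0 i1 i2)%R.
Proof.
move=> ri; have [c hc] : exists c, forall b, exists a, ~ S [:: a; b; c; i0; i1; i2].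
  apply: contrapT => nex; move: ri; rewrite leNgt => /negP; apply; apply/S_cut => c.
  apply: contrapT => nb; apply: nex; exists c => b; apply/existsNP => hb.
  by apply: nb; exists b.
pose N0 := maxn c (maxn i0 (maxn i1 i2)).
have [| |T hT] := @finite_collection ('I_N0 * 'I_N0 * 'I_N0 * 'I_N0)%type
  (fun '(N, j0, j1, j2) T => forall B t, settles (verified N j0 j1 j2) N B t ->
     (forall s, verified N j0 j1 j2 B s) -> t < T).
- by move=> [[[N j0] j1] j2] m n mn h B t st /(h _ _ st) /leq_trans; apply.
- move=> [[[N j0] j1] j2].
  have [[B [t [st hv]]]|nex] := pselect (exists B t,
      settles (verified N j0 j1 j2) N B t /\ forall s, verified N j0 j1 j2 B s).
    by exists t.+1 => B' t' st' hv'; rewrite ltnS (settles_inj hv hv' st st').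
  by exists 0 => B t st hv; case: nex; exists B, t.
exists T => t q Tt [N [j0 [j1 [j2 [B [[h0 h1 h2] -> st hv]]]]]].
rewrite ltNge; apply/negP => /code_leP ij.
have [NN0|N0N] := ltnP N N0.
  have := hT (Ordinal NN0, Ordinal (leq_ltn_trans h0 NN0),
    Ordinal (leq_ltn_trans h1 NN0), Ordinal (leq_ltn_trans h2 NN0)) B t st hv.
  by rewrite ltnNge Tt.
(* The witness [b <= B] might vary with the stage [s]; the pigeonhole gives one that serves all
   stages, against the choice of [c]. *)
have [| |b hb] := @finite_pigeonhole 'I_B.+1
  (fun b s => forall a, a < s.+1 -> S [:: a; nat_of_ord b; c; i0; i1; i2]).
- by move=> b m n mn h a am; apply: h; apply: leq_trans mn.
- move=> s; have := N0N; rewrite !geq_max => /andP[cN /and3P[i0N i1N i2N]].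
  have [b [bB hb]] := hv s i0 i0N i1 i1N i2 i2N ij c cN.
  by exists (Ordinal bB).
by have [a] := hc b; apply; apply: (hb a).
Qed.

Lemma active_upper_density : (0 <= r <= 1)%R ->
  upper_density (block_set active) = r.
Proof.
move=> r01; apply: block_set_upper_density => // e e0.
  have /rat_in_itvoo[q] : (r < r + e)%R by rewrite ltrDl.
  rewrite in_itv/= => /andP[rq qe]; have [a [b [d qE]]] := @code_val_rat R q.
  have [|T hT] := @active_above a b d; first by rewrite qE ltW.
  exists T => t p Tt /(hT _ _ Tt) pq; rewrite qE in pq.
  exact: ltW (lt_trans pq qe).
move=> T.
have /rat_in_itvoo[q] : (r - e < r)%R by rewrite ltrBlDr ltrDl.
rewrite in_itv/= => /andP[req qr]; have [a [b [d qE]]] := @code_val_rat R q.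
have [|t Tt act] := @active_below a b d T; first by rewrite qE.
by exists t, (code_val a b d); split=> //; rewrite qE.
Qed.

Definition stage_witness (s x t N j0 j1 j2 B : nat) : Prop :=
  t`! <= x /\ x < (t.+1)`! /\ j0 <= N /\ j1 <= N /\ j2 <= N /\
  (x %% t).+1 * j2.+1 + j1 * t <= j0 * t /\
  settles (verified N j0 j1 j2) N B t /\ verified N j0 j1 j2 B s.

(** All parameters are bounded by [x], so this is decidable when [S] is, and quantifying universally
    over [s] gives a Pi^0_1 condition on [x]. *)
Definition block_stage (s x : nat) : Prop :=
  exists t, t < x.+1 /\ exists N, N < x.+1 /\ exists j0, j0 < x.+1 /\
  exists j1, j1 < x.+1 /\ exists j2, j2 < x.+1 /\ exists B, B < x.+1 /\
  stage_witness s x t N j0 j1 j2 B.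

Lemma block_slope x t j0 j1 j2 :
  ((x %% t)%N.+1%:R <= code_val j0 j1 j2 * t%:R :> R)%R <->
  (x %% t).+1 * j2.+1 + j1 * t <= j0 * t.
Proof.
rewrite /code_val mulrAC ler_pdivlMr ?ltr0n// mulrBl -!natrM lerBrDr -natrD.
by rewrite ler_nat.
Qed.

(** Forwards, the parameters are at most [t <= t! <= x]. Backwards, only finitely many tuples of
    parameters compete, so one of them survives all stages. *)
Lemma block_set_activeP x : block_set active x <-> forall s, block_stage s x.
Proof.
split.
  move=> [t [q [[tx xt] [N [j0 [j1 [j2 [B [[h0 h1 h2] -> st hv]]]]]] /block_slope sl]]] s.
  have le_tx : t <= x by apply: leq_trans tx; apply: fact_ge.
  have [[Nt [Bt _]] _] := st.
  exists t; split; first by [].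
  exists N; split; first by rewrite ltnS (leq_trans Nt).
  exists j0; split; first by rewrite ltnS (leq_trans h0)// (leq_trans Nt).
  exists j1; split; first by rewrite ltnS (leq_trans h1)// (leq_trans Nt).
  exists j2; split; first by rewrite ltnS (leq_trans h2)// (leq_trans Nt).
  exists B; split; first by rewrite ltnS (leq_trans Bt).
  by do 7 split=> //.
move=> hs.
pose I := ('I_x.+1 * 'I_x.+1 * 'I_x.+1 * 'I_x.+1 * 'I_x.+1 * 'I_x.+1)%type.
have [| |[[[[[t N] j0] j1] j2] B] h] := @finite_pigeonhole I
  (fun '(t, N, j0, j1, j2, B) s => stage_witness s x t N j0 j1 j2 B).
- move=> [[[[[t N] j0] j1] j2] B] m n mn [? [? [? [? [? [? [? hv]]]]]]].
  by do 7 split=> //; apply: verified_anti mn hv.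
- move=> s; have [t [tx [N [Nx [j0 [j0x [j1 [j1x [j2 [j2x [B [Bx h]]]]]]]]]]]] := hs s.
  by exists (Ordinal tx, Ordinal Nx, Ordinal j0x, Ordinal j1x, Ordinal j2x, Ordinal Bx).
have [tx [xt [h0 [h1 [h2 [sl [st _]]]]]]] := h 0.
exists (nat_of_ord t), (code_val j0 j1 j2); split; [by [] | | exact/block_slope].
exists (nat_of_ord N), (nat_of_ord j0), (nat_of_ord j1), (nat_of_ord j2), (nat_of_ord B).
by split=> // s; have [_ [_ [_ [_ [_ [_ [_]]]]]]] := h s.
Qed.

Lemma block_stage_computable : computable_pred S ->
  computable_pred (fun s => block_stage (nth 0 s 0) (nth 0 s 1)).
Proof.
move=> cS; rewrite /block_stage /stage_witness /settles /caught_up /verified /code_le.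
by computability.
Qed.

End active.

Lemma left_Pi0_upper_density {R : realType} (r : R) : (0 <= r <= 1)%R ->
  left_Pi0 3 r -> exists X : set nat, Pi0_set 1 X /\ upper_density X = r.
Proof.
move=> r01 /Pi0_3P[S cS hS].
have S_cut i0 i1 i2 : (code_val i0 i1 i2 < r)%R <->
    forall c, exists b, forall a, S [:: a; b; c; i0; i1; i2].
  by rewrite -(hS [tuple i0; i1; i2]) /= ratr_code.
exists (block_set (active (R := R) S)); split; last exact: active_upper_density.
apply/Pi0_1P.
exists (fun s => block_stage S (nth 0 s 0) (nth 0 s 1)).
  exact: block_stage_computable.
move=> v; rewrite block_set_activeP /= -[thead v]/(tnth v ord0) (tnth_nth 0).
by [].
Qed.

(** * From Sigma^0_2 sets to left-Pi^0_3 reals *)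

Local Open Scope nat_scope.

Section counting.
Variables (X : nat -> Prop) (Q : seq nat -> Prop).
Hypothesis QX : forall x, X x <-> exists b, forall a, Q [:: a; b; x].

(** For fixed [B] the count decreases with [s] until all false witnesses [b <= B] are refuted, and
    so ends at or below the true count; a large enough [B] makes it never fall below the true
    count. *)
Definition count_stage (m B s : nat) : nat :=
  \sum_(0 <= x < m)
    `[<exists b, b < B.+1 /\ forall a, a < s.+1 -> Q [:: a; b; x]>].

Lemma count_stage_anti m B s s' :
  s <= s' -> count_stage m B s' <= count_stage m B s.
Proof.
move=> ss'; apply: leq_sum => x _; case: asboolP => // -[b [bB hb]].
rewrite lt0b; apply/asboolP; exists b; split=> // a as_; apply: hb.
exact: leq_trans ss'.
Qed.

Lemma count_stage_le m B : exists s, count_stage m B s <= count_below X m.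
Proof.
have [| |s hs] := @finite_collection ('I_m * 'I_B.+1)%type
  (fun '(x, b) s => ~ X x -> exists2 a, a <= s & ~ Q [:: a; nat_of_ord b; nat_of_ord x]).
- by move=> [x b] i j ij h /h[a ai na]; exists a => //; apply: leq_trans ij.
- move=> [x b]; have [Xx|nXx] := pselect (X x); first by exists 0.
  suff [a na] : exists a, ~ Q [:: a; nat_of_ord b; nat_of_ord x].
    by exists a => _; exists a.
  by apply/existsNP => hQ; apply: nXx; apply/QX; exists b.
exists s; rewrite /count_stage /count_below !big_nat; apply: leq_sum => x /andP[_ xm].
case: asboolP => // -[b [bB hb]]; rewrite lt0b; apply/asboolP.
apply: contrapT => nXx; have [a as_] := hs (Ordinal xm, Ordinal bB) nXx.
by apply; apply: hb.
Qed.

Lemma count_stage_ge m : exists B, forall s, count_below X m <= count_stage m B s.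
Proof.
have [| |B hB] := @finite_collection 'I_m
  (fun x B => X x -> exists b, b < B.+1 /\ forall a, Q [:: a; b; nat_of_ord x]).
- move=> x i j ij h /h[b [bi hb]]; exists b; split=> //; exact: leq_trans ij.
- move=> x; have [/QX[b hb]|nXx] := pselect (X x); last by exists 0.
  by exists b => _; exists b.
exists B => s; rewrite /count_stage /count_below !big_nat; apply: leq_sum => x /andP[_ xm].
case: asboolP => // Xx; rewrite lt0b; apply/asboolP.
by have [b [bB hb]] := hB (Ordinal xm) Xx; exists b.
Qed.

(** This is [c / m > (a - b) / (d + 1) - 1 / (n + 1)] with denominators cleared, together with
    [m >= n] and [m > 0]. *)
Definition density_witness (c n a b d m : nat) : Prop :=
  n <= m /\ 0 < m /\
  a * n.+1 * m < c * d.+1 * n.+1 + b * n.+1 * m + d.+1 * m.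

Lemma density_witness_le c c' n a b d m : c <= c' ->
  density_witness c n a b d m -> density_witness c' n a b d m.
Proof.
move=> cc' [nm [m0 h]]; do 2 split=> //; apply: leq_trans h _.
by rewrite !leq_add2r !leq_mul2r cc' !orbT.
Qed.

Definition density_stage (s y n a b d : nat) : Prop :=
  exists m, m < y.+1 /\ exists B, B < y.+1 /\
  density_witness (count_stage m B s) n a b d m.

(** Forwards, a pair [(m, B)] valid at all stages is fixed by the pigeonhole and read at a stage
    where the count no longer exceeds the true one. Backwards, [B] is chosen to catch all elements
    below [m]. Both use monotonicity in the count. *)
Lemma density_stageP n a b d :
  (exists y, forall s, density_stage s y n a b d) <->
  exists m, density_witness (count_below X m) n a b d m.
Proof.
split=> [[y hy]|[m hm]].
  have [| |[m B] h] := @finite_pigeonhole ('I_y.+1 * 'I_y.+1)%type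
    (fun '(m, B) s => density_witness (count_stage m B s) n a b d m).
  - by move=> [m B] s s' ss'; apply: density_witness_le; apply: count_stage_anti.
  - by move=> s; have [m [my [B [By h]]]] := hy s; exists (Ordinal my, Ordinal By).
  have [s hs] := count_stage_le m B; exists m.
  exact: density_witness_le hs (h s).
have [B hB] := count_stage_ge m; exists (maxn m B) => s.
exists m; split; first by rewrite ltnS leq_maxl.
exists B; split; first by rewrite ltnS leq_maxr.
exact: density_witness_le (hB s) hm.
Qed.

Lemma density_stage_computable : computable_pred Q ->
  computable_pred (fun s => density_stage (nth 0 s 0) (nth 0 s 1) (nth 0 s 2)
    (nth 0 s 3) (nth 0 s 4) (nth 0 s 5)).
Proof.
move=> cQ; rewrite /density_stage /density_witness /count_stage.
by computability.
Qed.

End counting.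

Local Open Scope ring_scope.

(** * The cut of an upper density *)

Lemma density_witnessP {R : realType} (X : set nat) n a b d m :
  density_witness (count_below X m) n a b d m <->
  [/\ (n <= m)%N, (0 < m)%N & code_val a b d - n.+1%:R^-1 < (rho X m : R)].
Proof.
have E : (0 < m)%N -> (code_val a b d - n.+1%:R^-1 < (rho X m : R)) =
    (a * n.+1 * m < count_below X m * d.+1 * n.+1 + b * n.+1 * m + d.+1 * m)%N.
  move=> m0; rewrite rhoE /code_val ltr_pdivlMr ?ltr0n//.
  have dn0 : 0 < d.+1%:R * n.+1%:R :> R by rewrite mulr_gt0 ?ltr0n.
  rewrite -(ltr_pM2r dn0).
  have -> : ((a%:R - b%:R) / d.+1%:R - n.+1%:R^-1) * m%:R * (d.+1%:R * n.+1%:R) =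
      (a * n.+1 * m)%:R - (b * n.+1 * m)%:R - (d.+1 * m)%:R :> R.
    by rewrite !natrM; field; rewrite !nat1r !pnatr_eq0.
  by rewrite !ltrBlDr mulrA -!natrM -!natrD ltr_nat addnAC.
by split=> [[nm [m0 h]]|[nm m0 h]]; [split=> //; rewrite E|do 2 split=> //; rewrite -E].
Qed.

(** One [n] serves both as threshold for [m] and as tolerance, which saves a universal
    quantifier. *)
Lemma le_limsupP {R : realType} (u : nat -> R) (r q : R) : is_limsup u r ->
  q <= r <-> forall n, exists m, [/\ (n <= m)%N, (0 < m)%N & q - n.+1%:R^-1 < u m].
Proof.
move=> [ur ru]; split=> [qr n|h].
  have n0 : 0 < n.+1%:R^-1 :> R by rewrite invr_gt0 ltr0n.
  (* The threshold [n.+1] in place of [n] ensures [0 < m]. *)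
  have [m [nm hm]] := ru _ n0 n.+1; exists m; split; [exact: ltnW|exact: leq_trans nm|].
  by apply: le_lt_trans hm; rewrite lerD2r.
apply/ler_addgt0Pr => d d0; pose e := d / 2.
have e0 : 0 < e by rewrite divr_gt0.
(* Beyond [M] the tolerance is at most [e], so that [q < u m + e <= r + 2 e = r + d]. *)
have [N hN] := ur _ e0; pose M := Num.truncn e^-1.
have [m [nm _ hm]] := h (maxn N M).
have := hN m (leq_trans (leq_maxl _ _) nm).
suff : (maxn N M).+1%:R^-1 <= e.
  rewrite /e; move: hm; move: (_^-1) => i; lra.
rewrite invf_ple ?posrE ?ltr0n//; apply: ltW; apply: lt_le_trans (truncnS_gt _) _.
by rewrite ler_nat ltnS leq_maxr.
Qed.

Lemma code_le_computable a b d :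
  computable_pred (fun s => ~ code_le a b d (nth 0 s 3) (nth 0 s 4) (nth 0 s 5))%N.
Proof. by rewrite /code_le; computability. Qed.

Lemma left_Pi0_ratr {R : realType} (q : rat) : left_Pi0 3 (ratr q : R).
Proof.
have [a [b [d qE]]] := @code_val_rat R q; apply/Pi0_3P.
exists (fun s => ~ code_le a b d (nth 0 s 3) (nth 0 s 4) (nth 0 s 5))%N.
  exact: code_le_computable.
move=> v; rewrite /= ratr_code -qE; split=> [h _ |/(_ 0%N)[_ /(_ 0%N)] h].
  by exists 0%N => _ /(@code_leP R)/(lt_le_trans h); rewrite ltxx.
by rewrite ltNge; apply/negP => /code_leP.
Qed.

Lemma upper_density_left_Pi0 {R : realType} (X : set nat) (r : R) :
  Sigma0_set 2 X -> upper_density X = r -> left_Pi0 3 r.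
Proof.
move=> /Sigma0_2P[Q cQ hQ] /upper_densityP Xr.
have [[q <-]|irr] := pselect (exists q : rat, ratr q = r); first exact: left_Pi0_ratr.
have QX x : X x <-> exists b, forall a, Q [:: a; b; x].
  exact: (hQ [tuple x]).
(* The environment is [s], [y], [n] and then the code: the innermost quantifier is over stages, the
   middle one over the bound for [m] and [B], the outer one over tolerances. *)
apply/Pi0_3P; exists (fun s => density_stage Q (nth 0 s 0) (nth 0 s 1) (nth 0 s 2)
    (nth 0 s 3) (nth 0 s 4) (nth 0 s 5))%N; first exact: density_stage_computable.
move=> v; set q := rat_of_code v.
(* Irrationality of [r] turns the strict inequality of the cut into the weak one, which has the
   required Pi^0_3 form. *)
have -> : [set q : rat | ratr q < r]%classic q = (ratr q <= r) :> Prop.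
  rewrite /= le_eqVlt; case: eqP => // qr; case: irr; by exists q.
rewrite (le_limsupP _ Xr) {}/q ratr_code /=.
split=> h n; have := h n; rewrite (density_stageP QX).
  by move=> [m hm]; exists m; apply/(@density_witnessP R).
by move=> [m hm]; exists m; apply/(@density_witnessP R).
Qed.

Lemma Pi0_1_Sigma0_2 (X : set nat) : Pi0_set 1 X -> Sigma0_set 2 X.
Proof.
move=> /Pi0_1P[P cP hP]; apply/Sigma0_2P.
(* Entry 1 is the dummy existential variable and is skipped. *)
exists (fun s => P [:: nth 0 s 0; nth 0 s 2])%N; first by computability.
move=> v; rewrite hP; case: v => -[|x [|y s]] //= _.
by split=> [h|[_ h]]; first exists 0%N.
Qed.

Theorem proposition6p1 (R : realType) (r : R) (hr : 0 <= r <= 1) :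
  [<-> exists X : set nat, Sigma0_set 2 X /\ upper_density X = r;
       left_Pi0 3 r;
       exists X : set nat, Pi0_set 1 X /\ upper_density X = r].
Proof.
tfae.
- by move=> [X [SX Xr]]; apply: upper_density_left_Pi0 Xr.
- exact: left_Pi0_upper_density.
- by move=> [X [PX Xr]]; exists X; split=> //; apply: Pi0_1_Sigma0_2.
Qed.
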